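(* Let $f=x^3+Ax+B\in\mathbb{Z}[x]$ be a monic irreducible polynomial such that the largest positive integer $k$ with $k^2\mid A$ and $k^3\mid B$ is $1$. Put $D=\mathrm{disc}(f)$ and assume that the splitting field $L$ of $f$ over $\mathbb{Q}$ is abelian over $\mathbb{Q}$ (equivalently, $D$ is a square). Let $F$ be a positive integer and $a_1,a_2,\ldots,a_{\varphi(F)/3}$ integers such that, for every prime $p\nmid 3D$, $p$ splits completely in $L$ if and only if $p\equiv a_1,a_2,\ldots,a_{\varphi(F)/3}\pmod F$ (that is, $p$ is congruent modulo $F$ to one of the $a_i$). Let $(N_n)_{n\ge 0}$ be the ternary recurrence sequence given by $$N_0=0,\quad N_1=-A,\quad N_2=-B,\qquad N_{n+3}=-AN_{n+1}-BN_n\quad (n\ge 0).$$ Then for all primes $p$, with finitely many exceptions, $$DN_{p-1}^2\equiv\begin{cases}0 \pmod p & \text{if } p\equiv a_1,a_2,\ldots,a_{\varphi(F)/3}\pmod F;\\ A^4 \pmod p & \text{otherwise.}\end{cases}$$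
   Context: $\varphi$ is Euler's totient function and $\mathrm{disc}(f)$ the discriminant of $f$. Integers $F$ and $a_i$ with the stated property exist for every such $f$ and were determined explicitly by Huard, Spearman and Williams. *)

(* Defs.v *)
From HB Require Import structures.
From mathcomp Require Import all_boot all_order all_algebra all_fingroup.
From mathcomp Require Import all_solvable all_field.

Set Implicit Arguments.
Unset Strict Implicit.
Unset Printing Implicit Defensive.

Import GRing.Theory Num.Theory.
Local Open Scope ring_scope.

Definition cubic (A B : int) : {poly int} := 'X^3 + A *: 'X + B%:P.

(* Discriminant of a monic polynomial of degree n:                            *)
(* (-1)^(n(n-1)/2) Res(f, f'). MathComp's Sylvester matrix lists coefficients *)
(* in increasing degree, so its resultant differs from the usual one by       *)
(* (-1)^(deg f * deg f'), which is 1 when deg f' = deg f - 1.                 *)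
Definition disc (f : {poly int}) : int :=
  (-1) ^+ 'C((size f).-1, 2) * resultant f f^`().

Section Splitting.
Variable L : fieldExtType rat.

Definition ring_of_integers (x : L) : Prop :=
  integralOver (intr : int -> L) x.

(* Ideals of the ring of integers are predicates on L, compared extensionally. *)
Definition is_ideal (I : L -> Prop) : Prop :=
  [/\ forall x, I x -> ring_of_integers x,
      I 0,
      forall x y, I x -> I y -> I (x + y)
    & forall a x, ring_of_integers a -> I x -> I (a * x)].

Definition is_prime_ideal (P : L -> Prop) : Prop :=
  [/\ is_ideal P, ~ P 1
    & forall x y, ring_of_integers x -> ring_of_integers y ->
        P (x * y) -> P x \/ P y].

Definition principal_ideal (c x : L) : Prop :=
  exists2 y, ring_of_integers y & x = c * y.

Definition ideal_mul (I J : L -> Prop) (x : L) : Prop :=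
  exists s : seq (L * L),
    (forall u, u \in s -> I u.1 /\ J u.2) /\ x = \sum_(u <- s) u.1 * u.2.

(* p O_L is a product of [L : Q] pairwise distinct prime ideals. *)
Definition splits_completely (p : nat) : Prop :=
  exists P : 'I_(\dim {:L}) -> L -> Prop,
    [/\ forall i, is_prime_ideal (P i),
        forall i j, i != j -> ~ (forall x, P i x <-> P j x)
      & forall x, principal_ideal p%:R x <->
          (\big[ideal_mul/ring_of_integers]_i P i) x].

End Splitting.
Arguments splits_completely L p : clear implicits.

(* Main.v *)
Require Import Defs.
From HB Require Import structures.
From mathcomp Require Import all_boot all_order all_algebra all_fingroup.
From mathcomp Require Import all_solvable all_field.
From mathcomp Require Import ring.
Import GRing.Theory Num.Theory.
Local Open Scope ring_scope.

(* Let t be a root of f. As L is abelian, L = Q(t) has degree 3 and D = d^2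
   with d an integer; Lagrange interpolation at the conjugates of t shows that
   D O_L is contained in Z[t]. Let p be a prime not dividing 6BD.
   If f has a root r mod p, its other roots (- r +- d / f'(r)) / 2 are also in
   F_p, and p O_L is the product of the distinct primes (p, t - r_i); moreover
   f divides X^(p-1) - 1 mod p, so the linear functional X^n |-> N_n, which
   kills the multiples of f, gives N_(p-1) = N_0 = 0.
   If f has no root mod p, then O_L / p is a field, so every prime ideal above
   p equals p O_L and p does not split. Frobenius maps a root z of f in an
   extension of F_p to the other root (- z +- d / f'(z)) / 2, so X^(p-1) is
   congruent mod f to (- 1 +- d / (X f')) / 2, and since X f' is congruent to
   - (2AX + 3B) the functional yields D N_(p-1) = +- d A^2. *)

(** * The discriminant of a depressed cubic *)

Lemma size_depressed_cubic (R : nzRingType) (a b : R) :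
  size ('X^3 + a *: 'X + b%:P) = 4.
Proof.
rewrite -addrA size_polyDl size_polyXn // (leq_ltn_trans (size_polyD _ _)) //.
rewrite gtn_max (leq_ltn_trans (size_scale_leq _ _)) ?size_polyX //.
by rewrite (leq_ltn_trans (size_polyC_leq1 _)).
Qed.

(** Laplace expansion along the first row. Entries come from a function on [nat] rather than a
    matrix, so that an expansion of concrete size can be evaluated; [bump j] skips column [j]. *)
Fixpoint laplace_det {R : pzRingType} n (g : nat -> nat -> R) : R :=
  if n is m.+1 then
    \sum_(j < m.+1) (-1) ^+ j * g 0%N j *
      laplace_det m (fun i k => g i.+1 (bump j k))
  else 1.

Lemma laplace_det0 (R : pzRingType) (g : nat -> nat -> R) : laplace_det 0 g = 1.
Proof. by []. Qed.

Lemma laplace_detS (R : pzRingType) n (g : nat -> nat -> R) :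
  laplace_det n.+1 g = \sum_(j < n.+1) (-1) ^+ j * g 0%N j *
    laplace_det n (fun i k => g i.+1 (bump j k)).
Proof. by []. Qed.

Arguments laplace_det : simpl never.

Lemma laplace_detE (R : comNzRingType) n (g : nat -> nat -> R) :
  \det (\matrix_(i < n, j < n) g i j) = laplace_det n g.
Proof.
elim: n g => [|n IHn] g; first by rewrite det_mx00.
rewrite (expand_det_row _ ord0) laplace_detS; apply: eq_bigr => j _.
rewrite -IHn /cofactor mxE add0n mulrCA mulrA; congr (_ * \det _).
by apply/matrixP=> i k; rewrite !mxE.
Qed.

Lemma disc_cubic (A B : int) : disc (cubic A B) = - 4 * A ^+ 3 - 27 * B ^+ 2.
Proof.
have dc : (cubic A B)^`() = 3%:R *: 'X^2 + A%:P.
  by rewrite /cubic !derivE addr0 scaler_nat alg_polyC; ring.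
have sc : size (cubic A B) = 4 by exact: size_depressed_cubic.
have sd : size ((cubic A B)^`()) = 3.
  rewrite dc size_polyDl; first by rewrite size_scale ?size_polyXn.
  by rewrite size_scale ?size_polyXn // (leq_ltn_trans (size_polyC_leq1 _)).
(* Two shifted rows of coefficients of f, then three of f', as in the Sylvester matrix but indexed
   by plain naturals. *)
pose g i j := if (i < 2)%N then (cubic A B)`_(j - i) *+ (i <= j)%N
              else (cubic A B)^`()`_(j - (i - 2)) *+ (i - 2 <= j)%N.
have -> : disc (cubic A B) = - \det (\matrix_(i < 5, j < 5) g i j).
  rewrite /disc sc -[(4.-1)%N]/3%N mulN1r; congr (- _); rewrite /resultant.
  have: forall i j, Sylvester_mx (cubic A B) (cubic A B)^`() i j = g i j.
    move=> i j; rewrite Sylvester_mxE /g.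
    case: splitP => k ->.
      by have := ltn_ord k; rewrite [X in (_ < X)%N](congr1 predn sd) => ->.
    have -> : ((size (cubic A B)^`()).-1 + k = 2 + k)%N by rewrite sd.
    by rewrite ltnNge leq_addr /= addKn.
  (* The dimension depends on the sizes of f and f', so the matrix is generalized before these are
     rewritten. *)
  move: (Sylvester_mx _ _); rewrite sd sc => M MP.
  by congr (\det _); apply/matrixP=> i j; rewrite mxE MP.
have gE i j : g i j = if (i < 2)%N then [:: B; A; 0; 1]`_(j - i) *+ (i <= j)%N
              else [:: A; 0; 3]`_(j - (i - 2)) *+ (i - 2 <= j)%N.
  rewrite /g dc /cubic !coefE; case: ifP => _.
    by case: (j - i)%N => [|[|[|[|k]]]] /=; rewrite ?nth_nil; congr (_ *+ _);
      ring.
  by case: (j - (i - 2))%N => [|[|[|[|k]]]] /=; rewrite ?nth_nil;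
    congr (_ *+ _); ring.
rewrite laplace_detE.
do 5! rewrite ?laplace_detS !(big_ord_recl, big_ord0) !gE /=
  !(mulr0n, mulr1n, mulr0, mul0r, addr0, add0r).
rewrite !laplace_det0; ring.
Qed.

(** * Linear recurrences as functionals on polynomials *)

(** The linear functional on polynomials that sends ['X^n] to [u n]. *)
Definition umbral {R : nzRingType} (u : nat -> R) (q : {poly R}) : R :=
  \sum_(i < size q) q`_i * u i.

Section Umbral.
Variable R : comNzRingType.
Implicit Types (u v : nat -> R) (q : {poly R}).

Lemma umbral_wide n u q : (size q <= n)%N ->
  umbral u q = \sum_(i < n) q`_i * u i.
Proof.
move=> le_q_n; rewrite /umbral (big_ord_widen n (fun i => q`_i * u i)) //.
rewrite big_mkcond; apply: eq_bigr => i _; case: ltnP => // ?.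
by rewrite nth_default ?mul0r.
Qed.

Lemma umbralD u q1 q2 : umbral u (q1 + q2) = umbral u q1 + umbral u q2.
Proof.
rewrite (umbral_wide _ _ _ (size_polyD q1 q2)).
rewrite (umbral_wide _ u q1 (leq_maxl _ (size q2))).
rewrite (umbral_wide _ u q2 (leq_maxr (size q1) _)) -big_split /=.
by apply: eq_bigr => i _; rewrite coefD mulrDl.
Qed.

Lemma umbralZ u c q : umbral u (c *: q) = c * umbral u q.
Proof.
rewrite (umbral_wide _ _ _ (size_scale_leq c q)) /umbral big_distrr /=.
by apply: eq_bigr => i _; rewrite coefZ mulrA.
Qed.

Lemma umbralXn u n : umbral u 'X^n = u n.
Proof.
rewrite /umbral size_polyXn big_ord_recr big1 /= => [|i _].
  by rewrite add0r coefXn eqxx mul1r.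
by rewrite coefXn (ltn_eqF (ltn_ord i)) mul0r.
Qed.

Lemma umbral_mulXn u q n : umbral u ('X^n * q) = umbral (fun i => u (n + i)%N) q.
Proof.
have le_s : (size ('X^n * q)%R <= n + size q)%N.
  by rewrite (leq_trans (size_polyMleq _ _)) // size_polyXn.
rewrite (umbral_wide _ _ _ le_s) big_split_ord /= big1 ?add0r => [|i _].
  by apply: eq_bigr => i _; rewrite coefXnM ltnNge leq_addr /= addKn.
by rewrite coefXnM ltn_ord mul0r.
Qed.

(** Multiplication by ['X^n] shifts [u] by n, so each coefficient of [q] contributes a multiple of
    one instance of the recurrence. *)
Lemma umbral_linrec a b u q :
    (forall n, u n.+3 = - a * u n.+1 - b * u n) ->
  umbral u (('X^3 + a *: 'X + b%:P) * q) = 0.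
Proof.
move=> u_rec; rewrite !mulrDl -scalerAl mul_polyC !umbralD !umbralZ.
rewrite -['X in X in a * X]expr1 !umbral_mulXn /umbral !big_distrr -!big_split /=.
by rewrite big1 // => i _; rewrite !addSn !add0n u_rec; ring.
Qed.

End Umbral.

(** * The recurrence at p - 1, for f split and for f irreducible modulo p *)

(** The roots are nonzero because [b] is, hence they are distinct roots of ['X^(#|K|.-1) - 1]. So f
    divides this polynomial, and the functional takes the same value at ['X^(#|K|.-1)] as at 1. *)
Lemma linrec_split (K : finFieldType) (a b : K) (u : nat -> K) (rs : seq K) :
    b != 0 -> u 0%N = 0 ->
    (forall n, u n.+3 = - a * u n.+1 - b * u n) ->
    uniq rs -> 'X^3 + a *: 'X + b%:P = \prod_(r <- rs) ('X - r%:P) ->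
  u #|K|.-1 = 0.
Proof.
move=> nz_b u0 u_rec rs_uniq Df.
have nz_rs r : r \in rs -> r != 0.
  apply: contraTneq => ->; apply/negP => r0.
  have: root ('X^3 + a *: 'X + b%:P) 0 by rewrite Df root_prod_XsubC.
  by rewrite rootE !hornerE ?expr0n /= ?mulr0 ?add0r (negPf nz_b).
have: \prod_(r <- rs) ('X - r%:P) %| 'X^(#|K|.-1) - 1.
  rewrite uniq_roots_dvdp ?uniq_rootsE //; apply/allP=> r /nz_rs nz_r.
  rewrite rootE !hornerE subr_eq0 -(inj_eq (mulfI nz_r)) -exprS mulr1.
  by rewrite prednK ?expf_card // (cardD1 0).
rewrite -Df => /dvdpP[q Dq].
rewrite -(umbralXn _ u) -(subrK 1 'X^_) Dq umbralD mulrC umbral_linrec //.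
by rewrite add0r -[1]/('X^0) umbralXn.
Qed.

(** The Frobenius relation between a root z of f and z^p yields a polynomial [h], involving
    ['X^(p.-1)], that vanishes at z. So f divides [h], and the functional kills [h]. *)
Lemma linrec_inert p (a b d : 'F_p) (u : nat -> 'F_p) :
    prime p -> 2 != 0 :> 'F_p -> b != 0 ->
    d ^+ 2 = - 4 * a ^+ 3 - 27 * b ^+ 2 -> d != 0 ->
    (forall r, ~~ root ('X^3 + a *: 'X + b%:P) r) ->
    u 0%N = 0 -> u 1%N = - a -> u 2%N = - b ->
    (forall n, u n.+3 = - a * u n.+1 - b * u n) ->
  d ^+ 2 * u p.-1 ^+ 2 = a ^+ 4.
Proof.
move=> pr_p nz2 nz_b Dd nz_d norootf u0 u1 u2 u_rec.
set f := 'X^3 + a *: 'X + b%:P in norootf.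
have sz_f : size f = 4 by exact: size_depressed_cubic.
have irr_f : irreducible_poly f by apply: cubic_irreducible; rewrite ?sz_f.
have [E _ [z fz0 _]] := irredp_FAdjoin irr_f.
have fE y : (map_poly (in_alg E) f).[y] = y ^+ 3 + a%:A * y + b%:A.
  by rewrite !rmorphD /= map_polyXn linearZ /= map_polyX map_polyC !hornerE.
have fz : z ^+ 3 + a%:A * z + b%:A = 0 by rewrite -fE; apply/rootP.
have nz_z : z != 0.
  apply: contraNneq nz_b => z0; move: fz; rewrite z0 expr0n mulr0 !add0r => /eqP.
  by rewrite scaler_eq0 oner_eq0 orbF.
set y := z ^+ p.
have pE : p \in [pchar E] by rewrite pchar_lalg pchar_Fp.
have alg_p (c : 'F_p) : (c%:A : E) ^+ p = c%:A.
  by have := expf_card c; rewrite card_Fp // -(rmorphXn (in_alg E)) => ->.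
have fy : y ^+ 3 + a%:A * y + b%:A = 0.
  have /(congr1 (pFrobenius_aut pE)) := fz.
  by rewrite !rmorphD rmorphXn rmorphM rmorph0 /= !pFrobenius_autE !alg_p.
have neq_yz : y != z.
  (* A fixed point of Frobenius lies in the prime field, where f has no root. *)
  apply/negP=> eq_yz.
  have: z \in 1%VS by rewrite (Fermat's_little_theorem 1%AS) card_Fp // dimv1.
  case/vlineP=> r Dz; move: fz0; rewrite Dz fmorph_root => fr0.
  by have := norootf r; rewrite fr0.
set a' : E := a%:A in fz fy; set b' : E := b%:A in fz fy.
(* The discriminant is made opaque, so that [ring] treats it as an atom. *)
have [D DD] : exists D, D = - 4 * a ^+ 3 - 27 * b ^+ 2 by eexists.
have DE : D%:A = - 4 * a' ^+ 3 - 27 * b' ^+ 2.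
  by rewrite DD -in_algE !(rmorphB, rmorphXn, rmorphN, rmorphM, rmorph_nat).
have yz : y ^+ 2 + y * z + z ^+ 2 + a' = 0.
  have /eqP : (y - z) * (y ^+ 2 + y * z + z ^+ 2 + a') = 0.
    by rewrite -[RHS](subrr 0) -{1}fy -fz; ring.
  by rewrite mulf_eq0 subr_eq0 (negPf neq_yz) => /eqP.
(* The third root is - y - z, so 2y + z is the difference of the two roots other than z, while 3z^2
   + a = f'(z) is the product of the differences of z with them. The product of both squares to the
   discriminant. *)
have [d' Dd' Dy] : exists2 d' : 'F_p, d' ^+ 2 = d ^+ 2 &
    (2 * y + z) * (3 * z ^+ 2 + a') = d'%:A.
  have: ((2 * y + z) * (3 * z ^+ 2 + a')) ^+ 2 = (d%:A : E) ^+ 2.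
    have -> : (d%:A : E) ^+ 2 = - 4 * a' ^+ 3 - 27 * b' ^+ 2.
      by rewrite -DE DD -Dd -(rmorphXn (in_alg E)).
    apply/eqP; rewrite -subr_eq0; apply/eqP.
    transitivity (4 * (3 * z ^+ 2 + a') ^+ 2 *
        (y ^+ 2 + y * z + z ^+ 2 + a') +
      27 * (b' - z ^+ 3 - a' * z) * (z ^+ 3 + a' * z + b')); first by ring.
    by rewrite yz fz !mulr0 addr0.
  move/eqP; rewrite eqf_sqr => /orP[] /eqP->; first by exists d.
  by exists (- d); rewrite ?sqrrN ?scaleNr.
(* W = w^2 - 9bw - D for w = 2aX + 3b, which satisfies w W = - bD mod f. *)
pose W : {poly 'F_p} := (4 * a ^+ 2) *: 'X^2 + (- (6 * a * b)) *: 'X^1 +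
  (- (18 * b ^+ 2) - D) *: 'X^0.
(* Since z f'(z) = - w(z), the relation [Dy] reads - w(z) (2 z^(p-1) + 1) = d'. Multiplying by W(z)
   turns it into h(z) = 0. *)
pose h := (2 * b * D) *: 'X^(p.-1) + (b * D) *: 'X^0 + (- d') *: W.
have hz : (map_poly (in_alg E) h).[z] = 0.
  have hornerm c n : (map_poly (in_alg E) (c *: 'X^n)).[z] = c%:A * z ^+ n.
    by rewrite linearZ /= map_polyXn !hornerE.
  have Db : b' = - z ^+ 3 - a' * z by rewrite -[LHS]subr0 -fz; ring.
  have Dyz : y = z * z ^+ p.-1 by rewrite -exprS prednK ?prime_gt0.
  pose w := 2 * a' * z + 3 * b'.
  pose Wz := 4 * a' ^+ 2 * z ^+ 2 - 6 * a' * b' * z - 18 * b' ^+ 2 - D%:A.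
  have wWz : w * Wz = - (b' * D%:A) by rewrite /w /Wz DE Db; ring.
  have nz_w : w != 0.
    apply: contra_neq nz_d => w0; apply/eqP; move/eqP: wWz.
    rewrite w0 mul0r eq_sym oppr_eq0 mulf_eq0 !scaler_eq0 oner_eq0 !orbF.
    by rewrite (negPf nz_b) /= DD -Dd sqrf_eq0.
  have -> : (map_poly (in_alg E) h).[z] =
      2 * b' * D%:A * z ^+ p.-1 + b' * D%:A - d'%:A * Wz.
    rewrite /h /W !scalerDr !scalerA !rmorphD !hornerD !hornerm.
    rewrite -!in_algE !(rmorphB, rmorphXn, rmorphN, rmorphM, rmorph_nat) /=.
    by rewrite /Wz -/a' -/b'; ring.
  apply: (mulfI nz_w); rewrite mulr0 -Dy Dyz.
  transitivity (w * b' * D%:A * (2 * z ^+ p.-1 + 1) -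
    (2 * y + z) * (3 * z ^+ 2 + a') * (w * Wz)).
    by rewrite Dyz; ring.
  by rewrite wWz /w Dyz DE Db; ring.
have f_h : f %| h.
  apply: contraTT isT; rewrite -irreducible_poly_coprime // => co_fh.
  rewrite -(coprimep_map (in_alg E)) in co_fh.
  by have := coprimep_root co_fh fz0; rewrite hz eqxx.
have /eqP : umbral u h = 0.
  by case/dvdpP: f_h => q ->; rewrite mulrC umbral_linrec.
rewrite !(umbralD, umbralZ, umbralXn) u0 u1 u2.
(* The functional sends [W] to - 4a^2 b + 6a^2 b = 2a^2 b, which is where the common factor 2b comes
   from. *)
have -> : 2 * b * D * u p.-1 + b * D * 0 + - d' * (4 * a ^+ 2 * - b +
    - (6 * a * b) * - a + (- (18 * b ^+ 2) - D) * 0) =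
  (2 * b) * (D * u p.-1 - d' * a ^+ 2) by ring.
rewrite !mulf_eq0 (negPf nz2) (negPf nz_b) subr_eq0 /= => /eqP Du.
apply: (mulfI (expf_neq0 2 nz_d)).

transitivity ((D * u p.-1) ^+ 2); first by rewrite DD -Dd; ring.
by rewrite Du -Dd'; ring.
Qed.

(** * The cubic field and its integers *)

Lemma map_cubic (R : nzRingType) (A B : int) :
  map_poly intr (cubic A B) = 'X^3 + A%:~R *: 'X + (B%:~R)%:P :> {poly R}.
Proof.
by rewrite /cubic !rmorphD /= map_polyXn map_polyZ /= map_polyX map_polyC.
Qed.

Lemma irreducible_cubic_noroot (F : fieldType) (a b : F) r :
  irreducible_poly ('X^3 + a *: 'X + b%:P) -> ~~ root ('X^3 + a *: 'X + b%:P) r.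
Proof.
case=> _ irr; apply/negP=> /factor_theorem[q Dq].
have := irr ('X - r%:P); rewrite size_XsubC Dq dvdp_mulIr => /(_ isT isT).
by move/eqp_size; rewrite -Dq size_XsubC size_depressed_cubic.
Qed.

(** Irreducibility makes f the minimal polynomial of each root, so the Galois group is transitive on
    the roots. If g sends t0 to t and h fixes t0, then h fixes t because g and h commute; hence
    every root lies in Q(t0). *)
Lemma abelian_cubic_roots (A B : int)
  (f_irr : irreducible_poly (map_poly intr (cubic A B) : {poly rat}))
  (L : splittingFieldType rat)
  (L_split : splittingFieldFor 1%VS (map_poly intr (cubic A B) : {poly L}) {:L}%VS)
  (L_gal : galois 1%AS {:L}%AS)
  (L_abel : abelian 'Gal({:L}%AS / 1%AS)) :
  exists t0 t1 t2 : L,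
   [/\ map_poly intr (cubic A B) = ('X - t0%:P) * (('X - t1%:P) * ('X - t2%:P)),
       adjoin_degree 1%AS t0 = 3, <<1; t0>>%VS = {:L}%VS
     & forall t, t \in [:: t0; t1; t2] -> exists g : gal_of {:L}, g t0 = t].
Proof.
set f := map_poly intr _ in L_split.
have sz_f : size f = 4 by rewrite /f map_cubic size_depressed_cubic.
have mon_f : f \is monic.
  rewrite /f map_cubic monicE /lead_coef size_depressed_cubic !coefE /=.
  by rewrite mulr0 !addr0.
have Df : f = map_poly (in_alg L) (map_poly intr (cubic A B)).
  by rewrite -map_poly_comp; apply: eq_map_poly => i; rewrite /= scaler_int.
case: L_split => rs; rewrite eqp_monic ?monic_prod_XsubC // => /eqP Drs defL.
have minf t : t \in rs -> minPoly 1 t = f.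
  move=> rs_t; have /polyOver1P[m Dm] := minPolyOver 1%AS t.
  have ft0 : root f t by rewrite Drs root_prod_XsubC.
  have f1 : f \is a polyOver 1%AS by apply/polyOver1P; eexists; exact: Df.
  have := minPoly_dvdp f1 ft0; rewrite Dm Df dvdp_map => m_f.
  apply/eqP; rewrite -eqp_monic -?Dm -?Df ?monic_minPoly //.
  rewrite Dm Df eqp_map.
  case: f_irr => _ -> //; rewrite -(size_map_poly (in_alg L)) -Dm size_minPoly.
  by rewrite /adjoin_degree.
case: rs => [|t0 [|t1 [|t2 [|? ?]]]] in Drs defL minf *;
  try by move: sz_f; rewrite Drs size_prod_XsubC.
have deg0 : adjoin_degree 1%AS t0 = 3.
  by apply: succn_inj; rewrite -size_minPoly minf ?mem_head.
have conj t : t \in [:: t0; t1; t2] ->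
    exists2 g, g \in 'Gal({:L} / 1%AS)%g & g t0 = t.
  move=> rs_t; apply: normalField_root_minPoly; rewrite ?sub1v ?memvf //.
    by case/and3P: L_gal.
  by rewrite minf ?mem_head // Drs root_prod_XsubC.
exists t0, t1, t2; split => //; last first.
- by move=> t /conj[g _ Dg]; exists g.
- have gal0 : galois <<1%AS; t0>>%AS {:L}.
    by apply: galoisS L_gal; rewrite sub1v subvf.
  apply/eqP; rewrite eqEsubv subvf /= -{1}defL.
  apply/Fadjoin_seqP; split; first exact: sub1v.
  move=> t /conj[g g_gal <-].
  have /galois_fixedField <- := gal0.
  apply/fixedFieldP; rewrite ?memvf // => h h_gal.
  have gh : (g * h = h * g)%g.
    apply: (centsP L_abel) => //; apply: subsetP h_gal; apply: galS; exact: sub1v.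
  rewrite -galM ?memvf // gh galM ?memvf //.
  by rewrite (fixed_gal _ h_gal) ?memv_adjoin ?subvf.
- by rewrite -/f Drs !big_cons big_nil mulr1.
Qed.

Lemma cubic_of_roots (R : comNzRingType) (r0 r1 r2 : R) :
  ('X - r0%:P) * (('X - r1%:P) * ('X - r2%:P)) = 'X^3 +
    (- (r0 + r1 + r2)) *: 'X^2 + (r0 * r1 + r0 * r2 + r1 * r2) *: 'X +
    (- (r0 * r1 * r2))%:P.
Proof. by rewrite -!mul_polyC !rmorphN !rmorphD !rmorphM /=; ring. Qed.

Lemma cubic_vieta (R : comNzRingType) (a b r0 r1 r2 : R) :
    'X^3 + a *: 'X + b%:P = ('X - r0%:P) * (('X - r1%:P) * ('X - r2%:P)) ->
  [/\ r0 + r1 + r2 = 0, a = r0 * r1 + r0 * r2 + r1 * r2 & b = - (r0 * r1 * r2)].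
Proof.
rewrite cubic_of_roots => /polyP Df; split.
- have := Df 2; rewrite !coefE /= !(mulr0, addr0, add0r, mulr1) => /esym/eqP.
  by rewrite oppr_eq0 => /eqP.
- by have := Df 1; rewrite !coefE /= !(mulr0, addr0, add0r, mulr1).
- by have := Df 0; rewrite !coefE /= !(mulr0, addr0, add0r, mulr1).
Qed.

Lemma cubic_disc_roots (R : comNzRingType) (a b r0 r1 r2 : R) :
    'X^3 + a *: 'X + b%:P = ('X - r0%:P) * (('X - r1%:P) * ('X - r2%:P)) ->
  - 4 * a ^+ 3 - 27 * b ^+ 2 = ((r0 - r1) * (r0 - r2) * (r1 - r2)) ^+ 2.
Proof.
case/cubic_vieta=> s0 -> ->.
have -> : r2 = - r0 - r1 by rewrite -[RHS]addr0 -s0; ring.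
by ring.
Qed.

(** * Closure properties of the ring of integers *)

Section RingOfIntegers.
Variable L : fieldExtType rat.
Local Notation OL := (@ring_of_integers L).

Lemma ri_int z : OL z%:~R.
Proof. exact: (integral_id (intr : {rmorphism int -> L})). Qed.

Lemma ri_nat n : OL n%:R.
Proof. exact: (ri_int n). Qed.

Lemma ri_add x y : OL x -> OL y -> OL (x + y).
Proof. exact: (@integral_add _ _ (intr : {rmorphism int -> L})). Qed.

Lemma ri_sub x y : OL x -> OL y -> OL (x - y).
Proof. exact: (@integral_sub _ _ (intr : {rmorphism int -> L})). Qed.

Lemma ri_mul x y : OL x -> OL y -> OL (x * y).
Proof. exact: (@integral_mul _ _ (intr : {rmorphism int -> L})). Qed.

Lemma ri_exp x n : OL x -> OL (x ^+ n).
Proof.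
move=> Ox; elim: n => [|n IHn]; first exact: (ri_int 1).
by rewrite exprS; apply: ri_mul.
Qed.

Lemma ri_horner (q : {poly int}) x : OL x -> OL (map_poly intr q).[x].
Proof.
move=> Ox; rewrite horner_poly.
elim/big_ind: _ => [||i _]; [exact: (ri_int 0) | exact: ri_add |].
by apply: ri_mul; [exact: ri_int | exact: ri_exp].
Qed.

(** The rational number is moved to [algC], where a rational algebraic integer is known to be an
    integer. *)
Lemma ri_rat q : OL q%:A -> exists z : int, q = z%:~R.
Proof.
case=> f mon_f fq0.
have fq: root (map_poly intr f) q.
  rewrite -(fmorph_root (in_alg L)) -map_poly_comp /=.
  by rewrite (eq_map_poly (g := intr)) // => i; rewrite /= scaler_int.
have: (ratr q : algC) \is a Num.int.
  apply: Cint_rat_Aint; first exact: Crat_rat.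
  apply: (root_monic_Aint (p := map_poly intr f)).
  - rewrite -(eq_map_poly (f := ratr \o intr)) => [|i].
      by rewrite map_poly_comp fmorph_root.
    by rewrite /= ratr_int.
  - exact: monic_map.
  - by apply/polyOverP => i; rewrite coef_map /= Num.Theory.intr_int.
case/intrP=> z /eqP; rewrite -(ratr_int algC z) fmorph_eq => /eqP ->.
by exists z.
Qed.

Lemma ratZ_intr z : (z%:~R : rat)%:A = z%:~R :> L.
Proof. exact: scaler_int. Qed.

Lemma intr_inj_ext : injective (intr : int -> L).
Proof.
by move=> z1 z2; rewrite -!ratZ_intr => /(fmorph_inj (in_alg L))/intr_inj.
Qed.

End RingOfIntegers.

Lemma ri_gal (L : splittingFieldType rat) (g : gal_of {:L}) (x : L) :
  ring_of_integers x -> ring_of_integers (g x).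
Proof.
case=> f mon_f fx; exists f => //.
rewrite -(eq_map_poly (f := g \o intr)) => [|i]; last by rewrite /= rmorph_int.
by rewrite map_poly_comp fmorph_root.
Qed.

(** * Integers of the cubic field as polynomials in a root *)

Section Cubic.
Variables (A B : int) (L : splittingFieldType rat) (t0 t1 t2 : L).
Local Notation OL := (@ring_of_integers L).
Local Notation D := (- 4 * A ^+ 3 - 27 * B ^+ 2).
Hypothesis f_roots : map_poly intr (cubic A B) =
  ('X - t0%:P) * (('X - t1%:P) * ('X - t2%:P)).

Lemma cubic_root_ri t : t \in [:: t0; t1; t2] -> OL t.
Proof.
move=> t_rs; exists (cubic A B).
  by rewrite monicE /lead_coef size_depressed_cubic !coefE /= mulr0 !addr0.
rewrite f_roots !rootM !root_XsubC; move: t_rs; rewrite !inE.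
by case/or3P=> /eqP->; rewrite eqxx ?orbT.
Qed.

Lemma disc_roots :
  D%:~R = ((t0 - t1) * (t0 - t2) * (t1 - t2)) ^+ 2 :> L.
Proof.
move: f_roots; rewrite map_cubic => /cubic_disc_roots <-.
by rewrite !(rmorphB, rmorphXn, rmorphN, rmorphM).
Qed.

(** Write x = q(t0) with q rational. The conjugates q(t_i) are integral, and solving for the
    coefficients of q costs one factor delta, the product of the root differences. A second factor
    delta gives D, and D times a coefficient is rational and integral, hence an integer. *)
Lemma ri_disc x :
    <<1; t0>>%VS = {:L}%VS -> adjoin_degree 1%AS t0 = 3 ->
    (forall t, t \in [:: t0; t1; t2] -> exists g : gal_of {:L}, g t0 = t) ->
    OL x ->
  exists2 c : {poly int}, (size c <= 3)%N & D%:~R * x = (map_poly intr c).[t0].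
Proof.
move=> t0_gen deg0 conj Ox.
pose k := Fadjoin_poly 1%AS t0 x.
have [q Dq] : exists q, k = map_poly (in_alg L) q.
  by apply/polyOver1P; apply: Fadjoin_polyOver.
have kx : k.[t0] = x by rewrite Fadjoin_poly_eq // t0_gen memvf.
have sz_q : (size q <= 3)%N.
  by have := size_Fadjoin_poly 1%AS t0 x; rewrite deg0 -/k Dq size_map_poly.
have Dx : x = (q`_0)%:A + (q`_1)%:A * t0 + (q`_2)%:A * t0 ^+ 2.
  rewrite -{1}kx Dq (horner_coef_wide (n := 3)) ?size_map_poly //.
  by rewrite !big_ord_recl big_ord0 !coef_map /= mulr1 addr0 addrA.
have conj_x t : t \in [:: t0; t1; t2] ->
    exists2 y, OL y & y = (q`_0)%:A + (q`_1)%:A * t + (q`_2)%:A * t ^+ 2.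
  case/conj=> g <-; exists (g x); first exact: ri_gal.
  by rewrite Dx !(rmorphD, rmorphXn, rmorphM) /= !linearZ /= !rmorph1.
have [x0 O0 D0] := conj_x t0 (mem_head _ _).
have [|x1 O1 D1] := conj_x t1; first by rewrite !inE eqxx orbT.
have [|x2 O2 D2] := conj_x t2; first by rewrite !inE eqxx !orbT.
have Ot0 : OL t0 by apply: cubic_root_ri; rewrite !inE eqxx.
have Ot1 : OL t1 by apply: cubic_root_ri; rewrite !inE eqxx orbT.
have Ot2 : OL t2 by apply: cubic_root_ri; rewrite !inE eqxx !orbT.
have int_coef i : exists z, D%:~R * q`_i = z%:~R :> rat.
  apply: (@ri_rat L); rewrite -in_algE rmorphM /= ratZ_intr disc_roots.
  pose delta := (t0 - t1) * (t0 - t2) * (t1 - t2).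
  suff: OL (delta * (delta * (q`_i)%:A)).
    by congr (integralOver _ _); rewrite /delta; ring.
  have mul_delta y : OL y -> y = delta * (q`_i)%:A ->
      OL (delta * (delta * (q`_i)%:A)).
    by move=> Oy <-; rewrite /delta; do !(apply: ri_mul || apply: ri_sub).
  have comb_ri c0 c1 c2 : OL c0 -> OL c1 -> OL c2 ->
      OL (x0 * c0 + x1 * c1 + x2 * c2).
    by move=> O3 O4 O5; do !(apply: ri_add || apply: ri_mul).
  (* The cases come in the order i >= 3, 2, 1, 0. The multipliers of x0, x1, x2 are the cofactors of
     the Vandermonde matrix of the roots. *)
  case: i => [|[|[|i]]] in mul_delta *; last first.
  - rewrite nth_default ?scale0r ?mulr0; first exact: ri_int 0.
    exact: leq_trans sz_q _.
  - apply: (mul_delta (x0 * (t1 - t2) + x1 * (t2 - t0) + x2 * (t0 - t1))).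
      by apply: comb_ri; apply: ri_sub.
    by rewrite D0 D1 D2 /delta; ring.
  - apply: (mul_delta (x0 * (t2 ^+ 2 - t1 ^+ 2) + x1 * (t0 ^+ 2 - t2 ^+ 2) +
       x2 * (t1 ^+ 2 - t0 ^+ 2))).
      by apply: comb_ri; apply: ri_sub; apply: ri_exp.
    by rewrite D0 D1 D2 /delta; ring.
  - apply: (mul_delta (x0 * (t1 * t2 * (t1 - t2)) + x1 * (t0 * t2 * (t2 - t0)) +
       x2 * (t0 * t1 * (t0 - t1)))).
      by apply: comb_ri; do !(apply: ri_mul || apply: ri_sub).
    by rewrite D0 D1 D2 /delta; ring.
have [c0 Dc0] := int_coef 0%N.
have [c1 Dc1] := int_coef 1%N.
have [c2 Dc2] := int_coef 2%N.
exists (\poly_(i < 3) [:: c0; c1; c2]`_i); first exact: size_poly.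
rewrite Dx (horner_coef_wide (n := 3)); last first.
  by rewrite (leq_trans (size_poly _ _)) ?size_poly.
rewrite !big_ord_recl big_ord0 !coef_map !coef_poly /=.
rewrite -!ratZ_intr -Dc0 -Dc1 -Dc2 -!in_algE !rmorphM /= !ratZ_intr.
by ring.
Qed.
End Cubic.

(** Over the rationals, a vanishing discriminant gives the double root - 3b/(2a) and the simple root
    3b/a; this identity exhibits the latter. *)
Lemma cubic_double_root (F : fieldType) (a b : F) : a != 0 ->
  a ^+ 3 * ((3 * b / a) ^+ 3 + a * (3 * b / a) + b) =
  - b * (- 4 * a ^+ 3 - 27 * b ^+ 2).
Proof. by move=> nz_a; field. Qed.

Lemma irreducible_cubic_disc (A B : int) :
  irreducible_poly (map_poly intr (cubic A B) : {poly rat}) ->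
  B != 0 /\ - 4 * A ^+ 3 - 27 * B ^+ 2 != 0.
Proof.
rewrite map_cubic => irr.
have noroot := irreducible_cubic_noroot _ _ _ _ irr.
have nz_B : B != 0.
  apply: contraNneq (noroot 0) => ->.
  by rewrite rootE !hornerE ?expr0n /= ?mulr0 ?add0r.
split=> //; apply/negP=> /eqP D0.
pose a : rat := A%:~R; pose b : rat := B%:~R.
have {}D0 : - 4 * a ^+ 3 - 27 * b ^+ 2 = 0.
  by rewrite /a /b -(rmorph0 intr) -D0 !(rmorphB, rmorphXn, rmorphN, rmorphM).
have nz_a : a != 0.
  apply: contra_eq_neq D0 => ->.
  by rewrite expr0n mulr0 sub0r oppr_eq0 mulf_neq0 ?expf_neq0 ?intr_eq0.
have /negP[] := noroot (3 * b / a).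
apply/eqP; rewrite !hornerE -/a -/b; apply: (mulfI (expf_neq0 3 nz_a)).
transitivity (a ^+ 3 * ((3 * b / a) ^+ 3 + a * (3 * b / a) + b)).
  by rewrite /= !mulrA.
by rewrite cubic_double_root // D0 !mulr0.
Qed.

(** The product of the root differences is a root of X^2 - D, so its degree is at most 2; the degree
    also divides 3, so this element is rational. Being integral, it is an integer. *)
Lemma abelian_cubic_disc_square (A B : int)
    (L : splittingFieldType rat) (t0 t1 t2 : L) :
    map_poly intr (cubic A B) = ('X - t0%:P) * (('X - t1%:P) * ('X - t2%:P)) ->
    \dim {:L} = 3 ->
  exists d : int, - 4 * A ^+ 3 - 27 * B ^+ 2 = d ^+ 2.
Proof.
move=> f_roots dimL; have := disc_roots _ _ _ _ _ _ f_roots.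
set delta := _ * (t1 - t2) => DE.
have sz2 : (adjoin_degree 1%AS delta <= 2)%N.
  rewrite -ltnS -size_minPoly.
  set D := - 4 * A ^+ 3 - 27 * B ^+ 2 in DE *.
  have sz_m : size ('X^2 - (D%:~R)%:P : {poly L}) = 3.
    rewrite size_polyDl ?size_polyXn // size_polyN.
    by rewrite (leq_ltn_trans (size_polyC_leq1 _)).
  rewrite -[X in (_ <= X)%N]sz_m dvdp_leq -?size_poly_eq0 ?sz_m //.
  apply: minPoly_dvdp; last by rewrite rootE !hornerE -DE subrr.
  by rewrite rpredB ?rpredX ?polyOverX ?polyOverC ?rpred_int.
have : (adjoin_degree 1%AS delta %| 3)%N.
  have := field_dimS (subvf <<1%AS; delta>>%AS).
  by rewrite dim_Fadjoin dimv1 muln1 dimL.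
have : (0 < adjoin_degree 1%AS delta)%N by rewrite /adjoin_degree.
have : (adjoin_degree 1%AS delta == 1) = (delta \in 1%VS).
  exact: adjoin_deg_eq1.
move: sz2; case: (adjoin_degree _ _) => [|[|[|n]]] //= _ /esym/vlineP[q Dq] _ _.
have [d Dd] : exists d : int, q = d%:~R.
  apply: (@ri_rat L); rewrite -Dq /delta.
  by do !(apply: ri_mul || apply: ri_sub);
    apply: (cubic_root_ri _ _ _ _ _ _ f_roots);
    rewrite !inE eqxx ?orbT.
exists d; apply: (@intr_inj_ext L).
by rewrite DE Dq Dd ratZ_intr rmorphXn.
Qed.

(** * Reduction modulo p and lifting back to the integers *)

Section ModP.
Variable p : nat.
Hypothesis p_pr : prime p.

Lemma intr_Fp_eq0 (z : int) : (z%:~R == 0 :> 'F_p) = (p %| z)%Z.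
Proof.
by rewrite (dvdz_pcharf (pchar_Fp p_pr)).
Qed.

Lemma intr_Fp_eq (y z : int) :
  (y%:~R = z%:~R :> 'F_p) <-> (y = z %[mod p%:Z])%Z.
Proof.
by split=> /eqP; [rewrite -subr_eq0 -rmorphB intr_Fp_eq0 -eqz_mod_dvd => /eqP |
  rewrite eqz_mod_dvd -intr_Fp_eq0 rmorphB subr_eq0 => /eqP].
Qed.

Lemma Fp_lift (a : 'F_p) : exists z : int, z%:~R = a.
Proof. by exists (val a)%:Z; rewrite -pmulrn natr_Zp. Qed.

Lemma poly_Fp_lift (q : {poly 'F_p}) :
  exists q' : {poly int}, map_poly intr q' = q.
Proof.
exists (map_poly (fun a : 'F_p => (val a)%:Z) q).
apply/polyP=> i; rewrite coef_map /= coef_poly.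
case: ltnP => [_|lei]; last by rewrite nth_default.
by rewrite -pmulrn natr_Zp.
Qed.

Lemma poly_Fp_eq0 (q : {poly int}) :
  map_poly intr q = 0 :> {poly 'F_p} -> exists q', q = p%:Z *: q'.
Proof.
move=> /polyP q0; exists (\poly_(i < size q) (q`_i %/ p)%Z).
apply/polyP=> i; rewrite coefZ coef_poly; case: ltnP => [_|lei]; last first.
  by rewrite mulr0 nth_default.
have := q0 i; rewrite coef_map coef0 => /eqP; rewrite intr_Fp_eq0 => p_qi.
by rewrite mulrC divzK.
Qed.

Lemma int_prime_bezout (m : int) :
  ~~ (p %| m)%Z -> exists e b : int, e * m + b * p%:Z = 1.
Proof.
move=> p_m; have [e [b Deb]] := Bezoutz m p%:Z.
exists e, b; rewrite Deb.
have : coprimez p m by rewrite coprimezE prime_coprime // -dvdzE.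
by rewrite coprimez_sym => /eqP.
Qed.

End ModP.

(** * Decomposition of p in the ring of integers *)

Section Ideals.
Variable L : fieldExtType rat.
Local Notation OL := (@ring_of_integers L).
Implicit Types (I J : L -> Prop) (x y g : L).

Lemma ri_is_ideal : is_ideal OL.
Proof.
by split=> //; [exact: (ri_int L 0) | exact: ri_add | exact: ri_mul].
Qed.

Lemma ideal_mul_subr I J x :
  (forall y, I y -> OL y) -> is_ideal J -> ideal_mul I J x -> J x.
Proof.
move=> I_O [_ J0 JD JM] [s [sIJ ->]]; rewrite big_seq.
by apply: big_ind => // u /sIJ[/I_O Ou1 Ju2]; apply: JM.
Qed.

Lemma ideal_mul_subl I J x :
  is_ideal I -> (forall y, J y -> OL y) -> ideal_mul I J x -> I x.
Proof.
move=> [_ I0 ID IM] J_O [s [sIJ ->]]; rewrite big_seq.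
by apply: big_ind => // u /sIJ[Iu1 /J_O Ou2]; rewrite mulrC; apply: IM.
Qed.

Lemma ideal_mul1 I J x y : I x -> J y -> ideal_mul I J (x * y).
Proof.
move=> Ix Jy; exists [:: (x, y)]; rewrite big_seq1; split=> // u.
by rewrite inE => /eqP->.
Qed.

Lemma ideal_mul_ideal I J : is_ideal I -> is_ideal J -> is_ideal (ideal_mul I J).
Proof.
move=> idI idJ; have [I_O I0 ID IM] := idI; have [J_O _ _ _] := idJ.
split.
- by move=> x /(ideal_mul_subl _ _ _ idI J_O)/I_O.
- by exists [::]; rewrite big_nil.
- move=> x y [s [sIJ ->]] [s' [s'IJ ->]]; exists (s ++ s'); rewrite big_cat.
  by split=> // u; rewrite mem_cat => /orP[/sIJ|/s'IJ].
- move=> a x Oa [s [sIJ ->]]; exists [seq (a * u.1, u.2) | u <- s]; split.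
    by move=> _ /mapP[u /sIJ[Iu1 Ju2] ->]; split=> //; apply: IM.
  by rewrite big_map mulr_sumr; apply: eq_bigr => u _; rewrite mulrA.
Qed.

Lemma prod_ideals_sub n (P : 'I_n -> L -> Prop) i x :
    (forall j, is_ideal (P j)) ->
  (\big[@ideal_mul L/OL]_j P j) x -> P i x.
Proof.
move=> idP.
have id_prod (r : seq 'I_n) : is_ideal (\big[@ideal_mul L/OL]_(j <- r) P j).
  elim/big_ind: _ => [|I J|j _] //; first exact: ri_is_ideal.
  exact: ideal_mul_ideal.
have: i \in index_enum 'I_n by rewrite mem_index_enum.
elim: (index_enum _) x => // j r IHr x; rewrite inE big_cons.
case: (id_prod r) => prod_O _ _ _; case: (idP j) => Pj_O _ _ _.
case/orP=> [/eqP -> | /IHr sub_i]; first by apply: ideal_mul_subl.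
by move/ideal_mul_subr => /(_ Pj_O (id_prod r))/sub_i.
Qed.

(** The ideal (p, g) of the ring of integers. *)
Definition gen2 (p : nat) g x :=
  exists u v, [/\ OL u, OL v & x = p%:R * u + g * v].

Lemma gen2_ideal p g : OL g -> is_ideal (gen2 p g).
Proof.
move=> Og; split.
- move=> _ [u [v [Ou Ov ->]]].
  by apply: ri_add; apply: ri_mul => //; exact: ri_nat.
- by exists 0, 0; rewrite !mulr0 addr0; split=> //; exact: (ri_int L 0).
- move=> _ _ [u [v [Ou Ov ->]]] [u' [v' [Ou' Ov' ->]]].
  exists (u + u'), (v + v'); split; [exact: ri_add | exact: ri_add | ring].
- move=> a _ Oa [u [v [Ou Ov ->]]].
  exists (a * u), (a * v); split; [exact: ri_mul | exact: ri_mul | ring].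
Qed.

Lemma gen2_p p g : gen2 p g p%:R.
Proof.
exists 1, 0; split; [exact: (ri_int L 1) | exact: (ri_int L 0) | ring].
Qed.

Lemma gen2_g p g : gen2 p g g.
Proof.
exists 0, 1; split; [exact: (ri_int L 0) | exact: (ri_int L 1) | ring].
Qed.

Lemma gen2_mul p g h x : OL g -> OL h ->
  ideal_mul (gen2 p g) (gen2 p h) x -> gen2 p (g * h) x.
Proof.
move=> Og Oh [s [sIJ ->]].
have [_ I0 ID IM] := gen2_ideal p (g * h) (ri_mul _ _ _ Og Oh).
rewrite big_seq; apply: big_ind => // u.
case/sIJ=> [[a [b [Oa Ob ->]]] [c [e [Oc Oe ->]]]].
exists (p%:R * a * c + g * b * c + a * h * e), (b * e); split; last by ring.
  by do !(apply: ri_add || apply: ri_mul) => //; exact: ri_nat.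
exact: ri_mul.
Qed.

Lemma ideal_mul_sub I I' J J' x :
  (forall y, I y -> I' y) -> (forall y, J y -> J' y) ->
  ideal_mul I J x -> ideal_mul I' J' x.
Proof.
by move=> sI sJ [s [sIJ ->]]; exists s; split=> // u /sIJ[/sI ? /sJ].
Qed.

Variable p : nat.
Hypothesis p_pr : prime p.

Lemma ideal_int_unit I (m : int) :
  is_ideal I -> I p%:R -> I m%:~R -> ~~ (p %| m)%Z -> I 1.
Proof.
move=> [_ _ ID IM] Ip Im /(int_prime_bezout _ p_pr)[e [b Deb]].
rewrite -[1]/(1%:~R) -Deb rmorphD !rmorphM /=.
by apply: ID; apply: IM => //; exact: ri_int.
Qed.

(** A Bezout relation e m + b p = 1 writes 1 as the sum of e s + b p in I and e t in J; multiplying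
    x by each summand gives an element of the product. *)
Lemma comaximal_mul I J s t (m : int) x :
    is_ideal I -> is_ideal J -> I p%:R -> I s -> J t ->
    s + t = m%:~R -> ~~ (p %| m)%Z -> I x -> J x ->
  ideal_mul I J x.
Proof.
move=> idI idJ Ip Is Jt Dst /(int_prime_bezout _ p_pr)[e [b Deb]] Ix Jx.
have [I_O I0 ID IM] := idI; have [J_O J0 JD JM] := idJ.
have [_ _ IJD _] := ideal_mul_ideal _ _ idI idJ.
have -> : x = (e%:~R * s + b%:~R * p%:R) * x + x * (e%:~R * t).
  transitivity ((e%:~R * (s + t) + b%:~R * p%:R) * x); last by ring.
  have := congr1 (intr : int -> L) Deb; rewrite Dst rmorphD !rmorphM /= => ->.
  by rewrite mul1r.
apply: IJD; apply: ideal_mul1 => //.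
  by apply: ID; apply: IM => //; exact: ri_int.
by apply: JM => //; exact: ri_int.
Qed.

End Ideals.
Arguments gen2 {L}.

(** * Factorization of p when D O_L lies in Z[t] and p does not divide D *)

Section MonogenicMod.
Variables (A B D : int) (L : fieldExtType rat) (t : L) (p : nat).
Local Notation OL := (@ring_of_integers L).
Local Notation ev q := (map_poly intr q).[t].
Hypothesis p_pr : prime p.
Hypothesis p_D : ~~ (p %| D)%Z.
Hypothesis D_int : forall x, OL x ->
  exists2 c : {poly int}, (size c <= 3)%N & D%:~R * x = ev c.
Hypothesis Ot : OL t.
Hypothesis ft0 : ev (cubic A B) = 0.
Hypothesis deg_t : adjoin_degree 1%AS t = 3.

Lemma ev_eq0 (q : {poly int}) : (size q <= 3)%N -> ev q = 0 -> q = 0.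
Proof.
move=> sz_q q0.
pose q' : {poly L} := map_poly intr q.
have q'1 : q' \is a polyOver 1%AS.
  by apply/polyOverP => i; rewrite coef_map /= rpred_int.
have q'0 : q' = 0.
  apply/eqP; apply: contraTT isT => nz_q'.
  have := dvdp_leq nz_q' (minPoly_dvdp q'1 (introT eqP q0)).
  by rewrite size_minPoly deg_t ltnNge (leq_trans (size_poly _ _)).
apply/polyP=> i; apply: (@intr_inj_ext L).
by have := congr1 (fun r : {poly L} => r`_i) q'0; rewrite /= coef_map !coef0.
Qed.

(** As D is invertible modulo p, x is congruent modulo p to a polynomial in t, and modulo t - a this
    becomes its value at a. *)
Lemma residue_mod (x : L) (a : int) : OL x ->
  exists m : int, gen2 p (t - a%:~R) (x - m%:~R).
Proof.
move=> Ox; have [c _ Dx] := D_int _ Ox.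
have [e [b Deb]] := int_prime_bezout _ p_pr _ p_D.
have /factor_theorem[w Dw] : root (c - (c.[a])%:P) a.
  by rewrite rootE !hornerE subrr.
have Dc : ev c = ev w * (t - a%:~R) + (c.[a])%:~R.
  rewrite -[c in LHS](subrK (c.[a])%:P) Dw rmorphD rmorphM rmorphB /=.
  by rewrite map_polyX !map_polyC !hornerE.
exists (e * c.[a]), (b%:~R * x), (e%:~R * ev w); split.
- by apply: ri_mul => //; exact: ri_int.
- by apply: ri_mul; [exact: ri_int | exact: ri_horner].
transitivity (e%:~R * (D%:~R * x) + b%:~R * p%:R * x - (e * c.[a])%:~R).
  have := congr1 (intr : int -> L) Deb; rewrite rmorphD !rmorphM /= => Deb'.
  by rewrite mulrA -mulrDl Deb' mul1r.
by rewrite Dx Dc rmorphM /=; ring.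
Qed.

Section Prime.
Variables a b c : int.
Hypothesis abc : exists2 w : L, OL w &
  (t - a%:~R) * ((t - b%:~R) * (t - c%:~R)) = p%:R * w.

Lemma Ot_sub (z : int) : OL (t - z%:~R).
Proof. by apply: ri_sub => //; exact: ri_int. Qed.

(** If 1 were in the ideal, multiplying by h = (t - b)(t - c) would put h in p O_L. Then D h = p q
    with q an integer polynomial in t of degree at most 2, and comparing coefficients of t^2 gives p
    | D. *)
Lemma gen2_proper : ~ gen2 p (t - a%:~R) 1.
Proof.
case=> u [v [Ou Ov D1]]; have [w Ow Dw] := abc.
pose h : {poly int} := ('X - b%:P) * ('X - c%:P).
have Dh : ev h = (t - b%:~R) * (t - c%:~R).
  by rewrite rmorphM !rmorphB /= map_polyX !map_polyC !hornerE.
have Oy : OL (u * ev h + w * v).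
  by apply: ri_add; apply: ri_mul => //; apply: ri_horner.
have Dy : ev h = p%:R * (u * ev h + w * v).
  transitivity (p%:R * u * ev h + p%:R * w * v); last by ring.
  by rewrite -Dw -Dh -[LHS]mul1r {1}D1; ring.
have [q sz_q Dq] := D_int _ Oy.
have sz_h : size h = 3.
  by rewrite size_Mmonic ?monicXsubC ?polyXsubC_eq0 ?size_XsubC.
have : D *: h - p%:Z *: q = 0.
  apply: ev_eq0.
    rewrite (leq_trans (size_polyD _ _)) // size_polyN geq_max.
    by rewrite !(leq_trans (size_scale_leq _ _)) ?sz_h.
  rewrite rmorphB /= !map_polyZ /= hornerD hornerN !hornerZ -Dq -pmulrn.
  by rewrite {1}Dy; ring.
move/(congr1 (fun r : {poly int} => r`_2)); rewrite coefB !coefZ coef0.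
have -> : h`_2 = 1.
  have : lead_coef h = 1 by apply/eqP; rewrite -[_ == _]monicE monicMl monicXsubC.
  by rewrite /lead_coef sz_h.
rewrite mulr1 => /eqP; rewrite subr_eq0 => /eqP DD.
by case/negP: p_D; rewrite DD dvdz_mulr.
Qed.

(** Every class modulo the ideal contains an integer, so primality reduces to that of p in the
    integers. *)
Lemma gen2_prime : is_prime_ideal (gen2 p (t - a%:~R)).
Proof.
have idP := gen2_ideal _ p _ (Ot_sub a).
have [P_O P0 PD PM] := idP.
split=> // [|x y Ox Oy Pxy]; first exact: gen2_proper.
have [m Pm] := residue_mod x a Ox; have [n Pn] := residue_mod y a Oy.
have PB z1 z2 : gen2 p (t - a%:~R) z1 -> gen2 p (t - a%:~R) z2 ->
    gen2 p (t - a%:~R) (z1 - z2).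
  move=> P1 P2; apply: PD => //; rewrite -[- z2]mulN1r; apply: PM => //.
  exact: (ri_int L (-1)).
have Pp := gen2_p _ p (t - a%:~R).
have Pmn : gen2 p (t - a%:~R) (m * n)%:~R.
  have -> : (m * n)%:~R = x * y - (y * (x - m%:~R) + m%:~R * (y - n%:~R)).
    by rewrite rmorphM /=; ring.
  by apply: PB => //; apply: PD; apply: PM => //; exact: ri_int.
have : (p %| m * n)%Z.
  apply: contraTT isT => p_mn; exfalso; apply: gen2_proper.
  exact: (ideal_int_unit _ _ p_pr _ _ idP Pp Pmn).
have Pdvd z k : (p %| k)%Z ->
    gen2 p (t - a%:~R) (z - k%:~R) -> gen2 p (t - a%:~R) z.
  move=> /dvdzP[q ->] Pz; rewrite -[z](subrK (q * p)%:~R); apply: PD => //.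
  by rewrite rmorphM; apply: PM => //; exact: ri_int.
rewrite dvdzE abszM Euclid_dvdM // -!dvdzE => /orP[p_m | p_n].
  by left; apply: Pdvd Pm.
by right; apply: Pdvd Pn.
Qed.

End Prime.

Lemma distinct_gen2 (a b : int) :
    is_prime_ideal (gen2 p (t - a%:~R)) -> ~~ (p %| a - b)%Z ->
  ~ (forall x, gen2 p (t - a%:~R) x <-> gen2 p (t - b%:~R) x).
Proof.
move=> [idP nP1 _] nab eqP; have [_ _ PD PM] := idP.
apply/nP1/(ideal_int_unit _ _ p_pr _ (a - b) idP) => //.
  exact: gen2_p.
have -> : (a - b)%:~R = (t - b%:~R) + (-1) * (t - a%:~R) by rewrite rmorphB; ring.
apply: PD; first by apply/eqP; exact: gen2_g.
by apply: PM; [exact: (ri_int L (-1)) | exact: gen2_g].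
Qed.

(** The three ideals are pairwise comaximal, so their product contains their common element p.
    Conversely the product lies in the ideal generated by p and the product of the t - a_i, itself a
    multiple of p. *)
Lemma split_of_roots (a0 a1 a2 : int) :
    \dim {:L} = 3 ->
    ~~ (p %| a0 - a1)%Z -> ~~ (p %| a0 - a2)%Z -> ~~ (p %| a1 - a2)%Z ->
    (exists2 w : L, OL w &
      (t - a0%:~R) * ((t - a1%:~R) * (t - a2%:~R)) = p%:R * w) ->
  splits_completely L p.
Proof.
move=> dimL n01 n02 n12 abc; have [w Ow Dw] := abc.
pose P i := gen2 p (t - ([:: a0; a1; a2]`_i)%:~R).
have idP i : is_ideal (P i) by apply/gen2_ideal/Ot_sub.
have p0 := gen2_prime _ _ _ abc.
have p1 : is_prime_ideal (P 1%N).
  by apply: (gen2_prime a1 a0 a2); exists w => //; rewrite -Dw; ring.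
have p2 : is_prime_ideal (P 2%N).
  by apply: (gen2_prime a2 a0 a1); exists w => //; rewrite -Dw; ring.
rewrite /splits_completely dimL; exists P; split.
- by case=> [[|[|[|]]]].
- have sym i j : ~ (forall x, P i x <-> P j x) -> ~ (forall x, P j x <-> P i x).
    by move=> nij eq_ij; apply: nij => x; rewrite eq_ij.
  have q01 : ~ (forall x, P 0%N x <-> P 1%N x) by apply: distinct_gen2.
  have q02 : ~ (forall x, P 0%N x <-> P 2%N x) by apply: distinct_gen2.
  have q12 : ~ (forall x, P 1%N x <-> P 2%N x) by apply: distinct_gen2.
  by case=> [[|[|[|]]]] // ?; case=> [[|[|[|]]]] // ? _ //=; try apply: sym.
move=> x; rewrite !big_ord_recl big_ord0 /=.
(* The iterated product ends with its neutral element [OL], so the last factor occurs as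
   [ideal_mul (P 2%N) OL]. *)
have idJ2 : is_ideal (ideal_mul (P 2%N) OL).
  exact: ideal_mul_ideal (ri_is_ideal L).
have idJ1 := ideal_mul_ideal _ _ _ (idP 1%N) idJ2.
have J2P : forall y, P 2%N y -> ideal_mul (P 2%N) OL y.
  move=> y P2y; rewrite -[y]mulr1; apply: ideal_mul1 => //.
  exact: (ri_int L 1).
split=> [[y Oy ->] | Px].
- have Pp i : P i (p%:R * y).
    case: (idP i) => _ _ _ PM; rewrite mulrC; apply: PM => //.
    exact: gen2_p.
  have Pg i : P i (t - ([:: a0; a1; a2]`_i)%:~R) by exact: gen2_g.
  have Pp1 i : P i p%:R by exact: gen2_p.
  have J1y : ideal_mul (P 1%N) (ideal_mul (P 2%N) OL) (p%:R * y).
    apply: (comaximal_mul _ _ p_pr _ _ (t - a1%:~R)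
      ((-1) * (t - a2%:~R)) (a2 - a1)) => //.
    + case: idJ2 => _ _ _ PM; apply: PM; first exact: (ri_int L (-1)).
      exact: J2P (Pg 2%N).
    + by rewrite rmorphB /=; ring.
    + by rewrite -rpredN opprB.
    + exact: J2P.
  (* (t - a1)(t - a2) takes the value (a0 - a1)(a0 - a2) at t = a0, and the difference is (t - a0)(t
     + a0 - a1 - a2). *)
  apply: (comaximal_mul _ _ p_pr _ _ ((- (t + (a0 - a1 - a2)%:~R)) * (t - a0%:~R))
     ((t - a1%:~R) * (t - a2%:~R)) ((a0 - a1) * (a0 - a2))) => //.
  + case: (idP 0%N) => _ _ _ PM; apply: PM => //.
    rewrite -mulN1r; apply: ri_mul; first exact: (ri_int L (-1)).
    by apply: ri_add => //; exact: ri_int.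
  + by apply: ideal_mul1; [exact: (Pg 1%N) | apply: J2P (Pg 2%N)].
  + by rewrite rmorphM !rmorphB /=; ring.
  + rewrite dvdzE abszM Euclid_dvdM // -!dvdzE negb_or; exact/andP.
have sJ2 y : ideal_mul (P 2%N) OL y -> P 2%N y by apply: ideal_mul_subl.
have sJ1 y : ideal_mul (P 1%N) (ideal_mul (P 2%N) OL) y ->
    gen2 p ((t - a1%:~R) * (t - a2%:~R)) y.
  move=> Jy; apply: gen2_mul; [exact: Ot_sub | exact: Ot_sub |].
  by apply: ideal_mul_sub Jy => // z /sJ2.
have : gen2 p ((t - a0%:~R) * ((t - a1%:~R) * (t - a2%:~R))) x.
  apply: gen2_mul; [exact: Ot_sub | by apply: ri_mul; exact: Ot_sub |].
  exact: ideal_mul_sub Px.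
rewrite Dw => -[u [v [Ou Ov ->]]]; exists (u + w * v); last by ring.
by apply: ri_add => //; apply: ri_mul.
Qed.

(** Write D x = c(t). If c vanishes modulo p, then p divides x. Otherwise c is coprime to f modulo
    p, having smaller degree, and a Bezout relation inverts c(t) modulo p. *)
Lemma inert_invertible (x : L) :
    irreducible_poly (map_poly intr (cubic A B) : {poly 'F_p}) -> OL x ->
  principal_ideal p%:R x \/ exists y z, [/\ OL y, OL z & x * y = 1 + p%:R * z].
Proof.
move=> irr_f Ox; have [c sz_c Dx] := D_int _ Ox.
have [c0|nz_c] := eqVneq (map_poly intr c : {poly 'F_p}) 0; [left|right].
  have [c' Dc] := poly_Fp_eq0 _ p_pr _ c0.
  have [e [b Deb]] := int_prime_bezout _ p_pr _ p_D.
  exists (e%:~R * ev c' + b%:~R * x).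
    by apply: ri_add; apply: ri_mul => //; try exact: ri_int; exact: ri_horner.
  rewrite Dc map_polyZ hornerZ /= -pmulrn in Dx.
  transitivity (e%:~R * (D%:~R * x) + b%:~R * p%:R * x); last by rewrite Dx; ring.
  have := congr1 (intr : int -> L) Deb; rewrite rmorphD !rmorphM /= => Deb'.
  by rewrite mulrA -mulrDl Deb' mul1r.
have [U [V UV]] : exists U V : {poly 'F_p},
    U * map_poly intr (cubic A B) + V * map_poly intr c = 1.
  have : coprimep (map_poly intr (cubic A B)) (map_poly intr c : {poly 'F_p}).
    rewrite irreducible_poly_coprime //.
    apply/negP=> /(dvdp_leq nz_c); rewrite {1}map_cubic size_depressed_cubic.
    by rewrite ltnNge (leq_trans (size_poly _ _)).
  case/Bezout_eq1_coprimepP=> -[U V] /= UV; by exists U, V.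
have [U' DU] := poly_Fp_lift _ U; have [V' DV] := poly_Fp_lift _ V.
have [W DW] : exists W, U' * cubic A B + V' * c - 1 = p%:Z *: W.
  apply: (poly_Fp_eq0 _ p_pr).
  by rewrite rmorphB rmorphD !rmorphM rmorph1 /= DU DV UV subrr.
exists (D%:~R * ev V'), (ev W); split.
- by apply: ri_mul; [exact: ri_int | exact: ri_horner].
- exact: ri_horner.
rewrite mulrA [x * _]mulrC Dx.
have := congr1 (fun q => ev q) DW.
rewrite /= rmorphB rmorphD !rmorphM rmorph1 /= map_polyZ /= !hornerE ft0 -pmulrn.
by rewrite mulr0 add0r => <-; ring.
Qed.

(** An element of [P i] outside p O_L would be invertible modulo p and put 1 in [P i]. So all three
    ideals equal p O_L, against their distinctness. *)
Lemma inert_not_split :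
    irreducible_poly (map_poly intr (cubic A B) : {poly 'F_p}) ->
    \dim {:L} = 3 -> ~ splits_completely L p.
Proof.
move=> irr_f; rewrite /splits_completely => ->.
move=> [P [primeP distP prodP]].
have idP i : is_ideal (P i) by case: (primeP i).
have Pp i x : principal_ideal p%:R x -> P i x.
  by move/prodP; apply: prod_ideals_sub.
have PP i x : P i x <-> principal_ideal p%:R x.
  split; last exact: Pp.
  move=> Px; have [[P_O P0 PD PM] nP1 _] := primeP i.
  have [//|[y [z [Oy Oz Dxy]]]] := inert_invertible x irr_f (P_O _ Px).
  case: nP1; have -> : 1 = y * x + p%:R * (- z) by rewrite [y * x]mulrC Dxy; ring.
  apply: PD; first exact: PM.
  apply: Pp; exists (- z) => //; rewrite -mulN1r; apply: ri_mul => //.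
  exact: (ri_int L (-1)).
by apply: (distP ord0 ord_max) => // x; rewrite !PP.
Qed.

End MonogenicMod.

(** * Square discriminants modulo p, and the conclusion *)

(** Dividing f by X - r leaves X^2 + rX + r^2 + a, of discriminant - (3r^2 + 4a). Since d^2 = -
    (3r^2 + 4a) f'(r)^2, this is the square of d / f'(r), and the quadratic formula gives the other
    roots. *)
Lemma cubic_square_disc_split (F : fieldType) (a b d r : F) :
    2 != 0 :> F -> d ^+ 2 = - 4 * a ^+ 3 - 27 * b ^+ 2 -> d != 0 ->
    root ('X^3 + a *: 'X + b%:P) r ->
  exists r1 r2, [/\ uniq [:: r; r1; r2] &
   'X^3 + a *: 'X + b%:P = ('X - r%:P) * (('X - r1%:P) * ('X - r2%:P))].
Proof.
move=> nz2 Dd nz_d; rewrite rootE !hornerE => /eqP fr.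
have nz4 : 4 != 0 :> F by rewrite (natrM _ 2 2) mulf_neq0.
have Db : b = - r ^+ 3 - a * r by rewrite -[LHS]subr0 -fr; ring.
have Dd_r : d ^+ 2 = - (3 * r ^+ 2 + 4 * a) * (3 * r ^+ 2 + a) ^+ 2.
  by rewrite Dd Db; ring.
have nz_f' : 3 * r ^+ 2 + a != 0.
  apply: contra_neq nz_d => f'0; apply/eqP.
  by rewrite -sqrf_eq0 Dd_r f'0 expr0n mulr0.
pose s := d / (3 * r ^+ 2 + a).
have s2 : s ^+ 2 = - (3 * r ^+ 2 + 4 * a).
  by rewrite /s expr_div_n Dd_r mulfK // expf_neq0.
exists ((- r + s) / 2), ((- r - s) / 2).
set r1 := (_ + s) / 2; set r2 := (_ - s) / 2.
have Df : 'X^3 + a *: 'X + b%:P = ('X - r%:P) * (('X - r1%:P) * ('X - r2%:P)).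
  have r12 : r1 * r2 = r ^+ 2 + a.
    transitivity ((r ^+ 2 - s ^+ 2) / 4).
      by rewrite /r1 /r2; field; rewrite nz4.
    by rewrite s2; field.
  have r1r2 : r1 + r2 = - r by rewrite /r1 /r2; field.
  have s0 : r + r1 + r2 = 0 by rewrite -addrA r1r2 subrr.
  have Da : r * r1 + r * r2 + r1 * r2 = a by rewrite -mulrDr r1r2 r12; ring.
  have {}Db : - (r * r1 * r2) = b by rewrite -mulrA r12 Db; ring.
  by rewrite cubic_of_roots s0 Da Db oppr0 scale0r addr0.
split=> //; have DD := cubic_disc_roots _ _ _ _ _ _ Df.
have : ((r - r1) * (r - r2) * (r1 - r2)) ^+ 2 != 0.
  by rewrite -DD -Dd expf_neq0.
rewrite sqrf_eq0 !mulf_eq0 !negb_or !subr_eq0 /= !inE !negb_or.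
by case/andP=> /andP[-> ->] ->.
Qed.

Theorem corollary14 (A B : int)
  (f_irr : irreducible_poly (map_poly intr (cubic A B) : {poly rat}))
  (AB_red : forall k : int, 0 < k ->
     (k ^+ 2 %| A)%Z -> (k ^+ 3 %| B)%Z -> k <= 1)
  (L : splittingFieldType rat)
  (L_split : splittingFieldFor 1%VS (map_poly intr (cubic A B) : {poly L}) {:L}%VS)
  (L_gal : galois 1%AS {:L}%AS)
  (L_abel : abelian 'Gal({:L}%AS / 1%AS))
  (F : nat) (F_gt0 : (0 < F)%N)
  (a : 'I_(totient F %/ 3) -> int)
  (Fa_split : forall p : nat, prime p ->
     ~~ (p%:Z %| 3 * disc (cubic A B))%Z ->
     (splits_completely L p <-> exists i, (p%:Z = a i %[mod F%:Z])%Z))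
  (N : nat -> int)
  (N0 : N 0%N = 0) (N1 : N 1%N = - A) (N2 : N 2%N = - B)
  (Nrec : forall n : nat, N n.+3 = - A * N n.+1 - B * N n) :
  exists exceptions : seq nat, forall p : nat, prime p -> p \notin exceptions ->
    ((exists i, (p%:Z = a i %[mod F%:Z])%Z) ->
       (disc (cubic A B) * N p.-1 ^+ 2 = 0 %[mod p%:Z])%Z) /\
    (~ (exists i, (p%:Z = a i %[mod F%:Z])%Z) ->
       (disc (cubic A B) * N p.-1 ^+ 2 = A ^+ 4 %[mod p%:Z])%Z).
Proof.
have [nz_B nz_D] := irreducible_cubic_disc _ _ f_irr.
have [t0 [t1 [t2 [f_roots deg0 t0_gen conj]]]] :=
  abelian_cubic_roots _ _ f_irr _ L_split L_gal L_abel.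
have dimL : \dim {:L} = 3 by rewrite -t0_gen dim_Fadjoin deg0 dimv1.
have [d Dd] := abelian_cubic_disc_square _ _ _ _ _ _ f_roots dimL.
have D_int := ri_disc _ _ _ _ _ _ f_roots _ t0_gen deg0 conj.
have Ot : ring_of_integers t0.
  by apply: (cubic_root_ri _ _ _ _ _ _ f_roots); apply: mem_head.
have ft0 : (map_poly intr (cubic A B)).[t0] = 0.
  by rewrite f_roots hornerM hornerXsubC subrr mul0r.
rewrite disc_cubic in Fa_split *.
(* Excluding 2 allows the quadratic formula, excluding 3 and the divisors of D gives access to
   [Fa_split] and nonzero d, and excluding the divisors of B keeps roots modulo p away from 0. *)
exists (primes `|(6 * B * (- 4 * A ^+ 3 - 27 * B ^+ 2))%R|%N) => p p_pr.
set D := - 4 * A ^+ 3 - 27 * B ^+ 2 in Fa_split nz_D D_int Dd *.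
rewrite mem_primes p_pr absz_gt0 !mulf_neq0 // !andTb.
rewrite -[X in (X %| _)%N]/`|p%:Z|%N -dvdzE.
rewrite -(intr_Fp_eq0 _ p_pr) !rmorphM !mulf_eq0 !negb_or /=.
case/andP=> /andP[nz6 nzB] nzD.
have [nz2 nz3] : 2 != 0 :> 'F_p /\ 3 != 0 :> 'F_p.
  by apply/andP; rewrite -negb_or -mulf_eq0 -natrM.
have p_D : ~~ (p %| D)%Z by rewrite -(intr_Fp_eq0 _ p_pr).
have {}Fa_split : splits_completely L p <-> exists i, (p%:Z = a i %[mod F%:Z])%Z.
  by apply: Fa_split; rewrite // -(intr_Fp_eq0 _ p_pr) rmorphM mulf_neq0.
pose u n : 'F_p := (N n)%:~R.
pose a' : 'F_p := A%:~R; pose b' : 'F_p := B%:~R; pose d' : 'F_p := d%:~R.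
have u_rec n : u n.+3 = - a' * u n.+1 - b' * u n.
  by rewrite /u Nrec rmorphB !rmorphM rmorphN.
have DE : D%:~R = d' ^+ 2 by rewrite Dd rmorphXn.
have Dd' : d' ^+ 2 = - 4 * a' ^+ 3 - 27 * b' ^+ 2.
  by rewrite -DE !(rmorphB, rmorphXn, rmorphN, rmorphM).
have nz_d' : d' != 0 by rewrite -sqrf_eq0 -DE.
have u0 : u 0%N = 0 by rewrite /u N0.
rewrite -!(intr_Fp_eq _ p_pr) rmorphM !rmorphXn rmorph0 /= DE -/(u _) -/a'.
(* A root modulo p makes p split, and the absence of roots prevents it; through [Fa_split] each case
   contradicts one of the two congruence conditions. *)
have [/existsP[r fr] | /existsPn norootf] :=
  boolP [exists r : 'F_p, root ('X^3 + a' *: 'X + b'%:P) r].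
  have [r1 [r2 [r_uniq Df]]] :=
    cubic_square_disc_split _ _ _ _ _ nz2 Dd' nz_d' fr.
  have split_p : splits_completely L p.
    have [a0 Da0] := Fp_lift _ r; have [a1 Da1] := Fp_lift _ r1.
    have [a2 Da2] := Fp_lift _ r2.
    have [W DW] : exists W,
        ('X - a0%:P) * (('X - a1%:P) * ('X - a2%:P)) - cubic A B = p%:Z *: W.
      apply: (poly_Fp_eq0 _ p_pr); rewrite rmorphB /= map_cubic Df.
      rewrite !rmorphM !rmorphB /=.
      by rewrite map_polyX !map_polyC /= Da0 Da1 Da2 subrr.
    move: r_uniq; rewrite /= !inE !negb_or => /andP[/andP[n01 n02] /andP[n12 _]].
    apply: (split_of_roots D _ t0 _ p_pr p_D D_int Ot deg0 a0 a1 a2) => //.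
    - by rewrite -(intr_Fp_eq0 _ p_pr) rmorphB subr_eq0 /= Da0 Da1.
    - by rewrite -(intr_Fp_eq0 _ p_pr) rmorphB subr_eq0 /= Da0 Da2.
    - by rewrite -(intr_Fp_eq0 _ p_pr) rmorphB subr_eq0 /= Da1 Da2.
    exists (map_poly intr W).[t0]; first exact: ri_horner.
    have := congr1 (fun q => (map_poly intr q).[t0]) DW.
    rewrite /= rmorphB !rmorphM !rmorphB /= map_polyX !map_polyC map_polyZ /=.
    by rewrite hornerD hornerN ft0 subr0 !hornerE.
  split=> [_ | []]; last exact/Fa_split.
  have <- : u #|'F_p|.-1 = u p.-1 by rewrite card_Fp.
  rewrite (linrec_split _ a' b' u [:: r; r1; r2]) ?expr0n ?mulr0 //.
  by rewrite Df !big_cons big_nil mulr1.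
have irr_f : irreducible_poly (map_poly intr (cubic A B) : {poly 'F_p}).
  by rewrite map_cubic; apply: cubic_irreducible; rewrite ?size_depressed_cubic.
split=> [/Fa_split | _].
  have := inert_not_split _ _ _ _ _ _ p_pr p_D D_int Ot ft0 irr_f dimL.
  by move=> nsplit /nsplit.
rewrite (linrec_inert p a' b') // /u ?N1 ?N2 ?rmorphN //.
Qed.
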